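(* For every integer $n\ge 11$, $$\min\{f(P(n),M): M\in\mathcal{M}_1(P(n))\}=\left\lceil \frac{n+2}{6}\right\rceil .$$
   Context: For $n\ge 3$, $P(n)=P(n,2)$ is the simple graph with vertex set $\{u_i,v_i:0\le i\le n-1\}$ and edge set $\{u_iu_{i+2},\,u_iv_i,\,v_iv_{i+1}:0\le i\le n-1\}$, subscripts modulo $n$. The edges $u_iv_i$ are called spokes. For a perfect matching $M$ of a graph $G$, a forcing set of $M$ is a subset $S\subseteq M$ contained in no perfect matching of $G$ other than $M$; the forcing number $f(G,M)$ is the minimum cardinality of a forcing set of $M$. $\mathcal{M}_1(P(n))$ is the set of perfect matchings $M$ of $P(n)$ such that either (i) $M$ contains at least one spoke, and for any two (cyclically) consecutive spokes $u_iv_i,u_jv_j$ of $M$ the number of spokes $u_kv_k$ of $P(n)$ strictly between them, $j-i-1$ (with $j$ taken as the representative in $(i,i+n]$), is $\equiv 0\pmod 4$ (if $M$ has exactly one spoke $u_iv_i$, it is regarded as two consecutive spokes with $j=i+n$, so the number is $n-1$); or (ii) $M$ contains no spoke, $4\mid n$, and for some $i$, $M=\bigcup_{k=0}^{n/4-1}\{u_{i+4k}u_{i+4k+2},\,u_{i+4k+1}u_{i+4k+3},\,v_{i+4k}v_{i+4k+1},\,v_{i+4k+2}v_{i+4k+3}\}$. *)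

(* Defs.v *)
From mathcomp Require Import all_boot all_order all_algebra.

Set Implicit Arguments.
Unset Strict Implicit.
Unset Printing Implicit Defensive.

(* A finite simple graph on T is given by its set E of edges, an edge being the
   two-element set of its end vertices. *)
Section Forcing.
Variables (T : finType) (E : {set {set T}}).

Definition perfect_matching (M : {set {set T}}) : bool :=
  (M \subset E) && partition M [set: T].

Definition forcing_set (M S : {set {set T}}) : bool :=
  (S \subset M) &&
  [forall M' : {set {set T}},
     perfect_matching M' && (S \subset M') ==> (M' == M)].

Lemma forcing_set_self (M : {set {set T}}) :
  perfect_matching M -> forcing_set M M.
Proof.
move=> /andP[_ pM]; rewrite /forcing_set subxx /=; apply/forallP => M'.
apply/implyP => /andP[/andP[_ pM'] sMM']; apply/eqP/setP => B.
apply/idP/idP => [BM'|]; last exact: (subsetP sMM').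
have [covM _ _] := and3P pM; have [_ tM' M'0] := and3P pM'.
have /set0Pn[x xB] : B != set0 by apply: contraNneq M'0 => <-.
have : x \in cover M by rewrite (eqP covM) inE.
case/bigcupP => C CM xC.
by rewrite -(def_pblock tM' BM' xB) (def_pblock tM' (subsetP sMM' _ CM) xC).
Qed.

(* Meaningful when M is a perfect matching: M itself is then a forcing set
   (forcing_set_self), so the minimum is taken over a nonempty family. *)
Definition forcing_number (M : {set {set T}}) : nat :=
  #|[arg min_(S < M | forcing_set M S) #|S|]|.

End Forcing.

(* Subscripts are natural numbers reduced modulo n, with residues in 'Z_n;
   this is the intended object only for 1 < n. *)
Definition gp_vertex (n : nat) : finType := ('Z_n + 'Z_n)%type.

Definition u (n i : nat) : gp_vertex n := inl (inZp i).
Definition v (n i : nat) : gp_vertex n := inr (inZp i).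

Definition spoke (n i : nat) : {set gp_vertex n} := [set u n i; v n i].

(* The generalized Petersen graph P(n, 2), with the u-vertices on the inner rim. *)
Definition P (n : nat) : {set {set gp_vertex n}} :=
  [set [set u n i; u n (i + 2)] | i : 'I_n]
  :|: [set spoke n i | i : 'I_n]
  :|: [set [set v n i; v n (i + 1)] | i : 'I_n].

Lemma P_card2 (n : nat) (e : {set gp_vertex n}) :
  3 <= n -> e \in P n -> #|e| = 2.
Proof.
move=> n3.
have neq (i d : nat) : 0 < d < n -> inZp i != inZp (i + d) :> 'Z_n.
  move=> /andP[d0 dn]; rewrite -val_eqE /= Zp_cast; last exact: ltnW.
  by rewrite -[X in X %% n == _]addn0 eqn_modDl mod0n modn_small // eq_sym -lt0n.
case/setUP => [/setUP[]|] /imsetP[i _ ->]; rewrite cards2 //.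
  by rewrite /u (inj_eq (@inl_inj _ _)) neq.
by rewrite /v (inj_eq (@inr_inj _ _)) neq // (ltn_trans _ n3).
Qed.

(* A pair i < j <= i + n of subscripts of spokes of M with no spoke of M
   strictly between is a pair of cyclically consecutive spokes of M; when M has
   a single spoke, the only such pairs have j = i + n. *)
Definition consecutive_spokes (n : nat) (M : {set {set gp_vertex n}})
    (i j : nat) : Prop :=
  [/\ i < j <= i + n, spoke n i \in M, spoke n j \in M
    & forall k, i < k < j -> spoke n k \notin M].

Definition M1_spokes (n : nat) (M : {set {set gp_vertex n}}) : Prop :=
  (exists i, spoke n i \in M) /\
  (forall i j, consecutive_spokes M i j -> j - i - 1 = 0 %[mod 4]).

Definition M1_nospoke (n : nat) (M : {set {set gp_vertex n}}) : Prop :=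
  [/\ forall i, spoke n i \notin M, 4 %| n
    & exists i : nat, M = \bigcup_(k < n %/ 4)
        [set [set u n (i + 4 * k); u n (i + 4 * k + 2)];
             [set u n (i + 4 * k + 1); u n (i + 4 * k + 3)];
             [set v n (i + 4 * k); v n (i + 4 * k + 1)];
             [set v n (i + 4 * k + 2); v n (i + 4 * k + 3)]]].

Definition M1 (n : nat) (M : {set {set gp_vertex n}}) : Prop :=
  perfect_matching (P n) M /\ (M1_spokes M \/ M1_nospoke M).

Definition is_minimum (A : int -> Prop) (m : int) : Prop :=
  A m /\ forall k : int, A k -> (m <= k)%R.

(* Main.v *)
Require Import Defs.
From mathcomp Require Import all_boot all_order all_algebra zify.

Set Implicit Arguments.
Unset Strict Implicit.
Unset Printing Implicit Defensive.

Import Order.TTheory GRing.Theory Num.Theory.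

(** Cutting P(n,2) just before position i severs three edges, so a perfect
matching is a closed walk of length n on the 8 states of such a cut; the parity
of a state is constant along a walk, and M1 consists of the walks of even
parity.  A set S of marked edges forces M iff no other closed walk respects the
marks, and this is read off the relation D between the initial and the current
states of the walks that respect the marks so far and differ from M.

Lower bound: a finite potential on pairs (state of M, D) shows that
6 (number of marks) - (length) is at least 2 for every closed word of length at
least 3 that admits no deviating closed walk.  Upper bound: twelve words of
lengths 11 to 22, each of which leaves a relation D that is fixed by one common
loop word of length 12 with two marks, so that the loop can be inserted any
number of times. *)

(* The state (x, y, z) of the cut before position i records whether the edges
   u_(i-2) u_i, u_(i-1) u_(i+1) and v_(i-1) v_i are used.  Triples of marks or of
   labels at position i refer to u_i u_(i+2), u_i v_i and v_i v_(i+1), in this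
   order. *)
Definition state : Type := (bool * bool * bool)%type.

Definition labels (s t : state) : state :=
  let: (x, _, _) := s in let: (_, a, b) := t in (a, ~~ (x || a), b).

(** At position i, [~~ (x && a)] and [~~ (z && b)] keep u_i and v_i on at most one rim edge each;
    the equation makes both agree on whether the spoke is used. The last three conjuncts say that
    marked edges are used. *)
Definition allowed (c s t : state) : bool :=
  let: (x, y, z) := s in let: (y', a, b) := t in let: (ca, cs, cb) := c in
  [&& y' == y, ~~ (x && a), ~~ (z && b), (x || a) == (z || b),
      ca ==> a, cs ==> ~~ (x || a) & cb ==> b].

Local Notation zero := (false, false, false).

Definition weight (c : state) : nat := let: (a, s, b) := c in a + s + b.

(** [Some true], [None] and [Some false] index u-edges, spokes and v-edges, here and in [edge]. *)
Definition component (k : option bool) (c : state) : bool :=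
  match k with Some true => c.1.1 | None => c.1.2 | Some false => c.2 end.

Definition states : seq state :=
  [seq (xy, z) | xy <- [seq (x, y) | x <- [:: false; true], y <- [:: false; true]],
                 z <- [:: false; true]].

(* Relations on states are evaluated into 8 x 8 boolean matrices, so that the
   iterated relations below stay cheap to compute with. *)
Definition tabulate (r : rel state) : seq (seq bool) :=
  [seq [seq r s t | t <- states] | s <- states].

Definition rank (s : state) : nat := let: (x, y, z) := s in x.*2.*2 + y.*2 + z.

Definition entry (D : seq (seq bool)) (s t : state) : bool :=
  nth false (nth [::] D (rank s)) (rank t).

Lemma entry_tabulate r s t : entry (tabulate r) s t = r s t.
Proof. by case: s t => [[[] []] []] [[[] []] []]. Qed.

(** * The relation between end states of deviating walks *)

Definition predecessors (t : state) : seq state :=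
  let: (y, _, _) := t in
  [:: (false, y, false); (false, y, true); (true, y, false); (true, y, true)].

Lemma allowed_predecessors c s t : allowed c s t -> s \in predecessors t.
Proof.
case: s t c => [[x y] z] [[y' a] b] [[? ?] ?] /= /andP[/eqP-> _].
by case: x y z => [] [] [].
Qed.

(** Either a walk that has already deviated continues, or a walk that agreed with M so far, and
    hence started at [zero], leaves M in the step from m to t. *)
Definition advance (m m' c : state) (D : seq (seq bool)) : seq (seq bool) :=
  tabulate (fun s t =>
    has (fun r => allowed c r t && entry D s r) (predecessors t)
    || [&& s == zero, t != m' & allowed c m t]).

Lemma entry_advance m m' c D s t :
  reflect ((exists2 r, allowed c r t & entry D s r) \/
           [/\ s = zero, t != m' & allowed c m t])
    (entry (advance m m' c D) s t).
Proof.
rewrite entry_tabulate; apply: (iffP orP) => -[].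
- by case/hasP => r _ /andP[]; left; exists r.
- by case/and3P => /eqP; right.
- move=> [r cr Dr]; left; apply/hasP; exists r; last by rewrite cr.
  exact: allowed_predecessors cr.
- by case=> -> tm cm; right; rewrite eqxx tm cm.
Qed.

Definition initial : seq (seq bool) := tabulate (fun s t => (s == t) && (s != zero)).

Fixpoint deviations (m c : nat -> state) (n : nat) : seq (seq bool) :=
  if n is k.+1 then advance (m k) (m n) (c k) (deviations m c k)
  else initial.

Lemma deviationsP m c n s t : m 0 = zero ->
    (forall i, i < n -> allowed (c i) (m i) (m i.+1)) ->
  entry (deviations m c n) s t <->
  exists w : nat -> state,
    [/\ w 0 = s, w n = t, forall i, i < n -> allowed (c i) (w i) (w i.+1)
      & exists2 i, i <= n & w i != m i].
Proof.
move=> m0; elim: n t => [|n IHn] t cm /=.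
  rewrite entry_tabulate; split=> [/andP[/eqP<- s0]|[w [<- <- _ [i]]]].
    by exists (fun=> s); split=> //; exists 0; rewrite ?m0.
  by rewrite leqn0 => /eqP-> ; rewrite m0 eqxx.
have {}IHn r := IHn r (fun i lt_in => cm i (ltnW lt_in)).
split=> [/entry_advance[[r crt /IHn[w [w0 wr cw [i lei wi]]]]|[s0 tm cmt]]|].
- exists (fun i => if i <= n then w i else t); split; rewrite ?ltnn //.
    move=> j; rewrite ltnS => lejn; rewrite lejn; case: ltnP => [/cw//|lenj].
    by have -> : j = n by [lia]; rewrite wr.
  by exists i; rewrite ?lei // leqW.
- exists (fun i => if i <= n then m i else t); split; rewrite ?ltnn ?m0 ?s0 //.
    move=> j; rewrite ltnS => lejn; rewrite lejn; case: ltnP => [lt|lenj].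
      exact/cm/leqW.
    by have -> : j = n by lia.
  by exists n.+1; rewrite ?ltnn.
case=> w [w0 <- cw [i lei wi]]; apply/entry_advance.
(* Either w deviates before its last state, or its only deviation is the last state. *)
case: (boolP [exists j : 'I_n.+1, w j != m j]) => [/existsP[j wj]|].
  left; exists (w n); first exact: cw.
  apply/IHn; exists w; split=> // [k lekn|]; first exact/cw/leqW.
  by exists j => //; rewrite -ltnS ltn_ord.
move/existsPn => wm; have {}wm j : j <= n -> w j = m j.
  by rewrite -ltnS => ltj; apply/eqP; have := wm (Ordinal ltj); rewrite negbK.
have in1 : i = n.+1.
  by apply/eqP; rewrite eqn_leq lei ltnNge; apply: contra wi => /wm->.
right; rewrite -w0 wm // m0 -in1 wi; split=> //.
by rewrite -wm // in1; apply: cw.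
Qed.

(** * The potential on deviation relations *)

Definition below (D D' : seq (seq bool)) : bool := all2 (all2 implb) D D'.

Definition table : Type := seq (seq (seq (seq bool) * nat)).

(* A pair (D, v) in row [rank m] of a table stands for the inequality
   v - 10 <= 6 f - i, where i is the length and f the number of marks of any word
   leading to the state m with a relation containing D; the offset 10 keeps all
   stored values positive. *)
Definition covered (T : table) (m : state) (D : seq (seq bool)) (v : nat) : bool :=
  has (fun e => (e.2 <= v) && below e.1 D) (nth [::] T (rank m)).

(** A letter changes 6 f - i by 6 * weight c - 1. The truncation of [.-1] at 0 is ruled out by the
    test [0 < v] in [safe]. *)
Definition successors (m : state) (D : seq (seq bool)) (v : nat) :
    seq (state * seq (seq bool) * nat) :=
  [seq (m', advance m m' c D, (v + 6 * weight c).-1)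
    | m' <- states, c <- [seq c <- states | allowed c m m']].

(** If [entry D zero m] holds, a deviating walk has rejoined M and can follow it to the end, so no
    continuation forces M and the pair may be dropped. *)
Fixpoint safe (k : nat) (T : table) (m : state) (D : seq (seq bool)) (v : nat) : bool :=
  entry D zero m ||
  if k is k'.+1 then
    (0 < v) && all (fun e => safe k' T e.1.1 e.1.2 e.2) (successors m D v)
  else covered T m D v.

(** Worklist search that keeps only the weakest pairs. Its output is validated by
    [potential_closed], [potential_final] and [guarded_initial]. *)
Fixpoint saturate (fuel : nat) (T : table) (todo : seq (state * seq (seq bool) * nat)) :
    table :=
  match fuel, todo with
  | k.+1, (m, D, v) :: todo' =>
    if entry D zero m || covered T m D v then saturate k T todo'
    else
      let row := [seq e <- nth [::] T (rank m) | ~~ ((v <= e.2) && below D e.1)] in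
      saturate k (set_nth [::] T (rank m) ((D, v) :: row)) (todo' ++ successors m D v)
  | _, _ => T
  end.

Definition expand (l : seq (state * seq (seq bool) * nat)) :=
  flatten [seq successors e.1.1 e.1.2 e.2 | e <- l & ~~ entry e.1.2 zero e.1.1].

(* Expanding three steps before saturating discards the words of length 1 and 2
   (unmarked spokes), which violate the bound. *)
Definition potential : table :=
  Eval vm_compute in
    saturate (10 ^ 4)%N [::] (iter 3 expand [:: (zero, initial, 10)]).

Lemma potential_closed :
  all (fun m => all (fun e => safe 1 potential m e.1 e.2) (nth [::] potential (rank m)))
      states.
Proof. vm_compute. reflexivity. Qed.

(** With the offset 10, the value 12 stands for the required 6 f - i >= 2. *)
Lemma potential_final :
  all (fun e => (12 <= e.2) || has (fun s => entry e.1 s s) states)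
      (nth [::] potential (rank zero)).
Proof. by vm_compute. Qed.

(** * From the potential to a bound on closed words *)

Lemma all2_nth (S : Type) (r : rel S) (x : S) (s t : seq S) i :
  r x x -> all2 r s t -> r (nth x s i) (nth x t i).
Proof.
by move=> rx; elim: s t i => [|a s IHs] [|b t] [|i] //= /andP[] // _ /IHs.
Qed.

Lemma below_entry D D' s t : below D D' -> entry D s t -> entry D' s t.
Proof.
move=> b; have b1 := all2_nth (x := [::]) (rank s) isT b.
by apply/implyP; exact: (all2_nth (x := false) (rank t) isT b1).
Qed.

Lemma entry_advance_mono m m' c D D' :
  (forall s t, entry D s t -> entry D' s t) ->
  forall s t, entry (advance m m' c D) s t -> entry (advance m m' c D') s t.
Proof.
move=> sub s t /entry_advance[[r cr /sub D'r]|dev]; apply/entry_advance; last by right.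
by left; exists r.
Qed.

Lemma mem_states s : s \in states.
Proof. by case: s => [[[] []] []]. Qed.

Lemma mem_successors m m' c D v : allowed c m m' ->
  (m', advance m m' c D, (v + 6 * weight c).-1) \in successors m D v.
Proof.
move=> cmm'; apply/allpairsPdep; exists m', c; rewrite mem_filter cmm'.
by rewrite !mem_states.
Qed.

(** The invariant along a word; k is the number of letters still to be read before the table is
    consulted. *)
Definition guarded (k : nat) (m : state) (D : seq (seq bool)) (i f : nat) : Prop :=
  entry D zero m \/ exists D0 v,
    [/\ safe k potential m D0 v, (forall s t, entry D0 s t -> entry D s t)
      & v + i <= 6 * f + 10].

Lemma guarded_advance k m m' c D i f : allowed c m m' ->
  guarded k.+1 m D i f -> guarded k m' (advance m m' c D) i.+1 (f + weight c).
Proof.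
move=> cmm' [Dm|[D0 [v [sv sub lev]]]].
  by left; apply/entry_advance; left; exists m.
move: sv => /= /orP[/sub Dm|/andP[v0 /allP/(_ _ (mem_successors D0 v cmm')) /= sv]].
  by left; apply/entry_advance; left; exists m.
right; exists (advance m m' c D0), (v + 6 * weight c).-1; split=> //.
  exact: entry_advance_mono.
by move: v0 lev {sv}; lia.
Qed.

(** The covering stored pair takes over, and [potential_closed] makes it safe for one more
    letter. *)
Lemma guarded_potential m D i f : guarded 0 m D i f -> guarded 1 m D i f.
Proof.
case=> [Dm|[D0 [v [sv sub lev]]]]; first by left.
move: sv => /= /orP[/sub Dm|/hasP[[D1 v1] e1 /andP[/= lev1 b1]]]; first by left.
right; exists D1, v1; split.
- have /allP/(_ _ (mem_states m))/allP/(_ _ e1) := potential_closed; exact.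
- by move=> s t /(below_entry b1)/sub.
- by apply: leq_trans lev; rewrite leq_add2r.
Qed.

Lemma guarded_initial : guarded 3 zero initial 0 0.
Proof. by right; exists initial, 10; split=> //; vm_compute. Qed.

Lemma guarded_final D i f : guarded 0 zero D i f ->
  (forall s, ~~ entry D s s) -> i + 2 <= 6 * f.
Proof.
move=> g D0; case: g => [/negPn|[D1 [v [sv sub lev]]]]; first by rewrite D0.
move: sv => /= /orP[/sub/negPn|/hasP[[D2 v2] e2 /andP[/= lev2 b2]]].
  by rewrite D0.
have /allP/(_ _ e2)/orP[|/hasP[s _ /(below_entry b2)/sub/negPn]] := potential_final.
  by move=> /= v12; lia.
by rewrite D0.
Qed.

Lemma deviations_weight (m c : nat -> state) n :
    2 < n -> m 0 = zero -> m n = zero ->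
    (forall i, i < n -> allowed (c i) (m i) (m i.+1)) ->
    (forall s, ~~ entry (deviations m c n) s s) ->
  n + 2 <= 6 * \sum_(i < n) weight (c i).
Proof.
move=> n3 m0 mn cm; apply: guarded_final; rewrite -mn.
pose G k i := guarded k (m i) (deviations m c i) i (\sum_(j < i) weight (c j)).
have step k i : i < n -> G k.+1 i -> G k i.+1.
  by move=> ltin; rewrite /G big_ord_recr; apply/guarded_advance/cm.
have G0 : G 3 0 by rewrite /G big_ord0 m0; exact: guarded_initial.
(* Three letters exhaust [guarded_initial]; afterwards the table is consulted before each letter. *)
suff all_G i : i + 3 <= n -> G 0 (i + 3).
  by have := all_G (n - 3); rewrite subnK //; apply.
elim: i => [|i IHi] lei.
  by apply: (step 0 2) => //; apply: (step 1 1); [lia | apply: (step 2 0) => //; lia].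
by rewrite addSn in lei *; apply: (step _ _ lei); apply/guarded_potential/IHi/ltnW.
Qed.

(** * Perfect matchings as closed walks *)

Lemma perfect_matching_degree (T : finType) (E M : {set {set T}}) :
  set0 \notin E ->
  perfect_matching E M =
    (M \subset E) && [forall x, #|[set e in M | x \in e]| == 1].
Proof.
move=> E0; rewrite /perfect_matching; case: (boolP (M \subset E)) => //= sME.
have M0 : set0 \notin M by apply: contra E0; exact: (subsetP sME).
apply/and3P/forallP => [[/eqP covM tM _] x|deg].
  have /bigcupP[e eM xe] : x \in cover M by rewrite covM inE.
  rewrite (_ : [set f in M | x \in f] = [set e]) ?cards1 //.
  apply/setP => f; rewrite !inE; apply/andP/eqP => [[fM xf]|->//].
  by rewrite -(def_pblock tM fM xf) (def_pblock tM eM xe).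
have ex x : exists2 e, e \in M & x \in e.
  have /cards1P[e de] := deg x.
  have : e \in [set f in M | x \in f] by rewrite de set11.
  by rewrite inE => /andP[eM xe]; exists e.
split=> //.
  apply/eqP/setP => x; rewrite inE; apply/bigcupP.
  by have [e eM xe] := ex x; exists e.
apply/trivIsetP => e f eM fM; apply: contraR => /pred0Pn[x /andP[xe xf]].
have /cards1P[g dg] := deg x.
have : e \in [set g] by rewrite -dg inE eM.
have : f \in [set g] by rewrite -dg inE fM.
by rewrite !inE => /eqP-> /eqP->.
Qed.

(** Used with a, b, c the three edges at a vertex, to count those in X. *)
Lemma card_sub3 (T : finType) (X : {set T}) (A : pred T) (a b c : T) :
    a != b -> a != c -> b != c -> (forall x, x \in X -> A x = (x \in [:: a; b; c])) ->
  #|[set x in X | A x]| = (a \in X) + (b \in X) + (c \in X).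
Proof.
move=> ab ac bc XA.
have -> : [set x in X | A x] = [set x in [:: a; b; c] | x \in X].
  by apply/setP => x; rewrite !inE; case: (boolP (x \in X)) => [/XA->|];
     rewrite ?andbF //= !inE andbT.
rewrite (eq_card (B := mem (X :&: (a |: (b |: [set c]))))); last first.
  by move=> x; rewrite !inE andbC.
rewrite -sum1_card (eq_bigl (fun x => (x \in a |: (b |: [set c])) && (x \in X))).
  rewrite big_mkcondr /= !big_setU1 ?big_set1 ?inE ?negb_or ?ab ?ac ?bc //=.
  by rewrite addnA; do 3?case: (_ \in X).
by move=> x; rewrite !inE andbC.
Qed.

(** * Edges and degrees in P(n,2) *)

Section Graph.

Variable n : nat.
Local Notation edges := {set {set gp_vertex n}}.
Hypothesis n5 : 4 < n.

Definition edge (k : option bool) (i : nat) : {set gp_vertex n} :=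
  match k with
  | Some true => [set u n i; u n (i + 2)]
  | Some false => [set v n i; v n (i + 1)]
  | None => spoke n i
  end.

Arguments edge : simpl never.

Lemma inZp_eq i j : (inZp i == inZp j :> 'Z_n) = (i == j %[mod n]).
Proof. by rewrite -val_eqE /= Zp_cast //; lia. Qed.

Lemma eq_u i j : (u n i == u n j) = (i == j %[mod n]).
Proof. by rewrite (inj_eq (@inl_inj _ _)) inZp_eq. Qed.

Lemma eq_v i j : (v n i == v n j) = (i == j %[mod n]).
Proof. by rewrite (inj_eq (@inr_inj _ _)) inZp_eq. Qed.

Lemma modn_addl_neq i d : 0 < d < n -> (i == i + d %[mod n]) = false.
Proof.
move=> dn; rewrite -[X in X == _ %[mod _]]addn0 eqn_modDl mod0n modn_small; lia.
Qed.

Lemma mod_sum_addr i j d : (i + d == j + d %[mod n]) = (i == j %[mod n]).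
Proof. by rewrite eqn_modDr. Qed.

Lemma in_edge_u k i j :
  (u n j \in edge k i) =
    match k with
    | Some true => (j == i %[mod n]) || (j == i + 2 %[mod n])
    | Some false => false
    | None => j == i %[mod n]
    end.
Proof. by case: k => [[]|]; rewrite /edge !inE /spoke ?eq_u ?orbF. Qed.

Lemma in_edge_v k i j :
  (v n j \in edge k i) =
    match k with
    | Some true => false
    | Some false => (j == i %[mod n]) || (j == i + 1 %[mod n])
    | None => j == i %[mod n]
    end.
Proof. by case: k => [[]|]; rewrite /edge !inE /spoke ?eq_v. Qed.

Lemma edge_mod k i j : i = j %[mod n] -> edge k i = edge k j.
Proof.
move=> ij; have uv d : (u n (i + d) = u n (j + d)) * (v n (i + d) = v n (j + d)).
  by split; apply/eqP; rewrite ?eq_u ?eq_v mod_sum_addr ij.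
by move: (uv 0); rewrite !addn0 => -[eu ev]; case: k => [[]|];
   rewrite /edge /spoke ?uv ?eu ?ev.
Qed.

Lemma edge_inj k l i j : edge k i = edge l j -> k = l /\ i = j %[mod n].
Proof.
move=> e.
have eU m : (u n m \in edge k i) = (u n m \in edge l j) by rewrite e.
have eV m : (v n m \in edge k i) = (v n m \in edge l j) by rewrite e.
(* Equal edges with crossed ends would give 2 d = 0 modulo n, impossible as 0 < 2 d <= 4 < n. *)
have far d : 0 < d <= 2 -> i = j + d %[mod n] -> j = i + d %[mod n] -> False.
  move=> d2 ij ji; have /negP[] := negbT (@modn_addl_neq i (d + d) ltac:(lia)).
  by rewrite addnA -(modnDml (i + d)) -ji modnDml ij.
have kl : k = l.
  move: (eU i) (eU j) (eV i) (eV j); rewrite !in_edge_u !in_edge_v !eqxx /=.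
  by case: (k) (l) => [[]|] [[]|]; rewrite ?orbT.
split=> //; move: eU eV (far 1) (far 2); rewrite -kl {e kl far}.
case: k => [[]|] eU eV f1 f2.
- move: (eU i) (eU j); rewrite !in_edge_u !eqxx /=.
  case/esym/orP=> [/eqP//|/eqP ij]; case/orP=> [/eqP//|/eqP ji].
  by case: f2.
- move: (eV i) (eV j); rewrite !in_edge_v !eqxx /=.
  case/esym/orP=> [/eqP//|/eqP ij]; case/orP=> [/eqP//|/eqP ji].
  by case: f1.
- by move: (eU i); rewrite !in_edge_u eqxx => /esym/eqP.
Qed.

Lemma in_P e : reflect (exists k (i : 'I_n), e = edge k i) (e \in P n).
Proof.
rewrite /P !inE; apply: (iffP idP).
  case/orP => [/orP[]|] /imsetP[i _ ->]; first by exists (Some true), i.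
    by exists None, i.
  by exists (Some false), i.
case=> [[[]|]] [i ->]; apply/orP; [left; apply/orP; left|right|left; apply/orP; right];
  by apply/imsetP; exists i.
Qed.

Lemma edge_in_P k i : edge k i \in P n.
Proof.
have n0 : 0 < n by lia.
apply/in_P; exists k, (Ordinal (ltn_pmod i n0)).
by apply: edge_mod; rewrite /= modn_mod.
Qed.

Lemma set0_notin_P : set0 \notin P n.
Proof.
by apply/negP => /P_card2; rewrite cards0 => /(_ ltac:(lia)).
Qed.

Lemma subset_P_eq (X Y : edges) :
  X \subset P n -> Y \subset P n ->
  (forall k i, (edge k i \in X) = (edge k i \in Y)) -> X = Y.
Proof.
move=> sX sY XY; apply/setP => e; case: (in_P e) => [[k [i ->]]//|eP].
by apply/idP/idP => [/(subsetP sX)|/(subsetP sY)] /in_P.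
Qed.


Lemma edge_eq k l i j : (edge k i == edge l j) = (k == l) && (i == j %[mod n]).
Proof.
apply/eqP/andP => [/edge_inj[-> ->]//|[/eqP-> /eqP ij]]; exact: edge_mod.
Qed.

Lemma mod_neqS i : ((i == i.+1 %[mod n]) = false) * ((i == i.+2 %[mod n]) = false).
Proof. by split; [rewrite -[i.+1]addn1|rewrite -[i.+2]addn2];
  apply: modn_addl_neq; lia. Qed.

Lemma degree_u (X : edges) i : X \subset P n ->
  #|[set e in X | u n i.+2 \in e]| =
    (edge (Some true) i \in X) + (edge (Some true) i.+2 \in X)
      + (edge None i.+2 \in X).
Proof.
move=> sX; apply: card_sub3; rewrite ?edge_eq //= ?mod_neqS //.
move=> e /(subsetP sX)/in_P[k [j ->]]; rewrite !inE !edge_eq in_edge_u.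
rewrite -[i.+2]addn2 [i + 2 == _ + 2 %[mod _]]mod_sum_addr ![_ == j %[mod _]]eq_sym.
by case: k => [[]|] //=; rewrite ?orbF // orbC.
Qed.

Lemma degree_v (X : edges) i : X \subset P n ->
  #|[set e in X | v n i.+1 \in e]| =
    (edge (Some false) i \in X) + (edge (Some false) i.+1 \in X)
      + (edge None i.+1 \in X).
Proof.
move=> sX; apply: card_sub3; rewrite ?edge_eq //= ?mod_neqS //.
move=> e /(subsetP sX)/in_P[k [j ->]]; rewrite !inE !edge_eq in_edge_v.
rewrite -[i.+1]addn1 [i + 1 == _ + 1 %[mod _]]mod_sum_addr ![_ == j %[mod _]]eq_sym.
by case: k => [[]|] //=; rewrite ?orbF // orbC.
Qed.

Lemma perfect_matchingP (M : edges) :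
  perfect_matching (P n) M <->
  M \subset P n /\ forall i,
    (edge (Some true) i \in M) + (edge (Some true) i.+2 \in M)
      + (edge None i.+2 \in M) = 1 /\
    (edge (Some false) i \in M) + (edge (Some false) i.+1 \in M)
      + (edge None i.+1 \in M) = 1.
Proof.
rewrite perfect_matching_degree ?set0_notin_P //.
split=> [/andP[sM /forallP deg]|[sM deg]].
  split=> // i; rewrite -degree_u // -degree_v //.
  by split; apply/eqP.
rewrite sM; apply/forallP => -[] a.
  (* [a + (n - 2)] represents a - 2 modulo n. *)
  have -> : inl a = u n (a + (n - 2)).+2.
    rewrite -{1}[a]valZpK -/(u n a); apply/eqP; rewrite eq_u.
    by rewrite (_ : (a + _).+2 = a + n) ?modnDr //; lia.
  by rewrite degree_u // (deg _).1.
have -> : inr a = v n (a + (n - 1)).+1.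
  rewrite -{1}[a]valZpK -/(v n a); apply/eqP; rewrite eq_v.
  by rewrite (_ : (a + _).+1 = a + n) ?modnDr //; lia.
by rewrite degree_v // (deg _).2.
Qed.

(** * Marks and cut states of edge sets *)

Definition marks (X : edges) (i : nat) : state :=
  (edge (Some true) i \in X, edge None i \in X, edge (Some false) i \in X).

(* This is the state before position i + 2; the shift avoids subtraction. *)
Definition cut (X : edges) (i : nat) : state :=
  (edge (Some true) i \in X, edge (Some true) i.+1 \in X,
   edge (Some false) i.+1 \in X).

Lemma marks_periodic (X : edges) i j : i = j %[mod n] -> marks X i = marks X j.
Proof. by move=> ij; rewrite /marks !(edge_mod _ ij). Qed.

Lemma cut_periodic (X : edges) i j : i = j %[mod n] -> cut X i = cut X j.
Proof.
move=> ij; have ij1 : i.+1 = j.+1 %[mod n].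
  by apply/eqP; rewrite -[i.+1]addn1 -[j.+1]addn1 mod_sum_addr ij.
by rewrite /cut !(edge_mod _ ij) !(edge_mod _ ij1).
Qed.

Lemma marks_cut (M : edges) i : perfect_matching (P n) M ->
  marks M i.+2 = labels (cut M i) (cut M i.+1).
Proof.
case/perfect_matchingP => _ /(_ i)[d _]; rewrite /marks /=.
by move: d; do 3!case: (_ \in M).
Qed.

(** The degree equations at u_(i+2) and v_(i+2) are exactly the transition rule. *)
Lemma cut_allowed (M S : edges) i : perfect_matching (P n) M -> S \subset M ->
  allowed (marks S i.+2) (cut M i) (cut M i.+1).
Proof.
case/perfect_matchingP => _ d /subsetP sSM; rewrite /allowed /cut /marks eqxx /=.
have [d1 _] := d i; have [_ d2] := d i.+1.
have m k : (edge k i.+2 \in S) ==> (edge k i.+2 \in M) by apply/implyP => /sSM.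
have sE : ~~ ((edge (Some true) i \in M) || (edge (Some true) i.+2 \in M))
           = (edge None i.+2 \in M).
  by move: d1; do 3!case: (_ \in M).
rewrite sE !m !andbT; move: d1 d2; case: (edge None i.+2 \in M);
  by do 4!case: (_ \in M).
Qed.

Definition edge_set (x : nat -> state) : edges :=
  [set edge p.1 p.2 | p : option bool * 'I_n & component p.1 (x p.2)].

Lemma edge_set_sub x : edge_set x \subset P n.
Proof. by apply/subsetP => e /imsetP[p _ ->]; exact: edge_in_P. Qed.

Lemma in_edge_set x k i : (forall i j, i = j %[mod n] -> x i = x j) ->
  (edge k i \in edge_set x) = component k (x i).
Proof.
move=> xP; apply/imsetP/idP => [[[l j] /=]|kx].
  by rewrite inE /= => lx /edge_inj[-> /xP->].
have n0 : 0 < n by lia.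
exists (k, Ordinal (ltn_pmod i n0)); first by rewrite inE /= (xP _ i) ?modn_mod.
by apply: edge_mod; rewrite /= modn_mod.
Qed.

Lemma marks_edge_set x i : (forall i j, i = j %[mod n] -> x i = x j) ->
  marks (edge_set x) i = x i.
Proof. by move=> xP; rewrite /marks !in_edge_set //; case: (x i) => [[]]. Qed.

Lemma sum_component (x : nat -> state) :
  #|[pred p : option bool * 'I_n | component p.1 (x p.2)]| = \sum_(i < n) weight (x i).
Proof.
rewrite -sum1_card big_mkcond /=.
rewrite -(pair_bigA _ (fun k (i : 'I_n) => if component k (x i) then 1 else 0)) /=.
rewrite exchange_big; apply: eq_bigr => i _.
rewrite (bigD1 (Some true)) // (bigD1 None) // (bigD1 (Some false)) //= big1.
  by case: (x i) => [[[] []] []].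
by case=> [[]|].
Qed.

Lemma card_edge_set x : #|edge_set x| <= \sum_(i < n) weight (x i).
Proof.
by rewrite -sum_component -[leqRHS]cardsE; apply: leq_imset_card.
Qed.

Lemma sum_marks_le (X : edges) :
  \sum_(i < n) weight (marks X i) <= #|X|.
Proof.
rewrite -sum_component.
have inj : {in [pred p : option bool * 'I_n | component p.1 (marks X p.2)] &,
            injective (fun p : option bool * 'I_n => edge p.1 p.2)}.
  move=> [k i] [l j] _ _ /= /edge_inj[-> ij]; congr (_, _).
  by apply: val_inj; rewrite /= -(modn_small (ltn_ord i)) ij modn_small.
rewrite -(card_in_imset inj); apply: subset_leq_card.
by apply/subsetP => e /imsetP[[[[]|] i] ? ->].
Qed.

(** * From periodic walks to perfect matchings *)

Section Walk.

Variable s : nat -> state.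
Hypothesis s_periodic : forall i j, i = j %[mod n] -> s i = s j.
Hypothesis s_allowed : forall i, allowed zero (s i) (s i.+1).

Definition walk_matching : edges :=
  edge_set (fun i => labels (s i) (s i.+1)).

Lemma marks_walk i : marks walk_matching i = labels (s i) (s i.+1).
Proof.
apply: marks_edge_set => j k jk; rewrite (s_periodic jk).
congr labels; apply: s_periodic; apply/eqP.
by rewrite -[j.+1]addn1 -[k.+1]addn1 mod_sum_addr jk.
Qed.

Lemma cut_walk i : cut walk_matching i = s i.+2.
Proof.
move: (marks_walk i) (marks_walk i.+1) (s_allowed i.+1); rewrite /marks /cut.
case: (s i) (s i.+1) (s i.+2) => [[x y] z] [[x1 y1] z1] [[x2 y2] z2] /=.
by move=> [-> _ _] [-> _ ->] /and5P[/eqP-> _ _ _ _].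
Qed.

Lemma walk_perfect_matching : perfect_matching (P n) walk_matching.
Proof.
apply/perfect_matchingP; split=> [|i]; first exact: edge_set_sub.
move: (s_allowed i.+1) (s_allowed i.+2).
move: (marks_walk i) (marks_walk i.+1) (marks_walk i.+2); rewrite /marks.
case: (s i) (s i.+1) (s i.+2) (s i.+3) =>
  [[x y] z] [[x1 y1] z1] [[x2 y2] z2] [[x3 y3] z3] /=.
move=> [-> _ ->] [_ -> ->] [-> -> _].
rewrite !andbT => /and4P[/eqP-> _ b2 /eqP->] /and4P[_ c1 _ _]; split.
  by case: y1 y3 c1 => [] [].
by case: z1 z2 b2 => [] [].
Qed.

End Walk.

End Graph.

(** * Forcing sets and closed deviating walks *)

Section Forcing.

Variable n : nat.
Local Notation edges := {set {set gp_vertex n}}.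
Hypothesis n5 : 4 < n.

Lemma shift_residue p j : exists2 i, i < n & j = (p + i).+2 %[mod n].
Proof.
(* The residue of j - p - 2, written without subtracting p. *)
exists ((j + p * (n - 1) + (n - 2)) %% n); first by rewrite ltn_mod; lia.
rewrite -addn2 -addnA [_ + 2]addnC addnA modnDmr.
rewrite (_ : p + 2 + _ = j + p.+1 * n) 1?addnC ?modnMDl //.
by rewrite mulSn !mulnBr; nia.
Qed.

Lemma edge_in_marks (X Y : edges) k j :
  marks X j = marks Y j -> (edge n k j \in X) = (edge n k j \in Y).
Proof. by case: k => [[]|] -[]. Qed.

Lemma subset_allowed (S M : edges) p : S \subset P n -> perfect_matching (P n) M ->
    (forall i, i < n ->
       allowed (marks S (p + i).+2) (cut M (p + i)) (cut M (p + i).+1)) ->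
  S \subset M.
Proof.
move=> sSP pM aS; apply/subsetP => e eS.
have [k [j de]] := in_P _ (subsetP sSP e eS).
have [i ltin ji] := shift_residue p j.
have := marks_cut n5 (p + i) pM; have := aS i ltin.
rewrite de (edge_mod n5 k ji) {e de} in eS *; move: eS.
rewrite /marks; case: (cut M _) (cut M _) => [[x y] z] [[x' y'] z'] /=.
move=> eS /and5P[_ _ _ _ /and3P[/implyP a /implyP b /implyP c]] [d1 d2 d3].
by case: k eS => [[]|] eS; rewrite ?d1 ?d2 ?d3; auto.
Qed.

Lemma cut_inj (M M' : edges) p :
    perfect_matching (P n) M -> perfect_matching (P n) M' ->
  (forall i, i < n -> cut M (p + i) = cut M' (p + i)) -> M = M'.
Proof.
move=> pM pM' cMM'.
have {}cMM' i : cut M (p + i) = cut M' (p + i).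
  have n0 : 0 < n by lia.
  have e : p + i = p + i %% n %[mod n] by rewrite modnDmr.
  by rewrite !(cut_periodic n5 _ e) cMM' // ltn_mod.
apply: subset_P_eq; [by case/andP: pM | by case/andP: pM' | move=> k j].
have [i _ ji] := shift_residue p j; rewrite (edge_mod n5 k ji).
by apply: edge_in_marks; rewrite !marks_cut // -!addnS !cMM'.
Qed.

Lemma periodic_window (c w : nat -> state) :
    0 < n -> w n = w 0 ->
    (forall i, i < n -> allowed (c i) (w i) (w i.+1)) ->
  forall i, allowed (c (i %% n)) (w (i %% n)) (w (i.+1 %% n)).
Proof.
move=> n0 wn aw i; have lt := ltn_pmod i n0.
have -> : w (i.+1 %% n) = w (i %% n).+1; last exact: aw.
have e : i.+1 %% n = (i %% n).+1 %% n by rewrite -addn1 -modnDml addn1.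
rewrite e; have [{}e|ne] := eqVneq (i %% n).+1 n; first by rewrite e modnn wn.
by rewrite modn_small // ltn_neqAle ne.
Qed.

(** Perfect matchings containing S and different from M correspond to closed walks that respect the
    marks and deviate from M, that is, to diagonal entries of D. The base point p is chosen with
    state [zero] because [deviations] assumes that M starts there. *)
Lemma forcing_setP (M S : edges) p :
    perfect_matching (P n) M -> S \subset M -> cut M p = zero ->
  let D := deviations (fun i => cut M (p + i)) (fun i => marks S (p + i).+2) n in
  forcing_set (P n) M S <-> forall s, ~~ entry D s s.
Proof.
move=> pM sSM cp D; have n0 : 0 < n by lia.
have aM i : i < n ->
    allowed (marks S (p + i).+2) (cut M (p + i)) (cut M (p + i.+1)).
  by rewrite addnS => _; apply: cut_allowed.
have c0 : cut M (p + 0) = zero by rewrite addn0.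
have sSP : S \subset P n by apply: subset_trans sSM _; case/andP: pM.
have DP s t := @deviationsP _ _ n s t c0 aM.
split=> [/andP[_ /forallP fS] s|D0].
  apply/negP => /DP[w [w0 wn aw [i lein wi]]].
  have wP := periodic_window n0 (etrans wn (esym w0)) aw.
  (* K is -(p + 2) modulo n, so that w' at p + j + 2 is w at j; the 2 is the shift in [cut]. *)
  pose K := p * (n - 1) + (n - 2).
  pose w' j := w ((j + K) %% n).
  have w'P i1 i2 : i1 = i2 %[mod n] -> w' i1 = w' i2.
    by move=> e; rewrite /w' -modnDml e modnDml.
  have w'A j : allowed zero (w' j) (w' j.+1).
    rewrite /w' addSn; have := wP (j + K).
    move: (c in allowed c) => c.
    case: c (w _) (w _) => [[? ?] ?] [[? ?] ?] [[? ?] ?] /=.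
    by move=> /and5P[-> -> -> -> _].
  pose M' := walk_matching n w'.
  have pM' : perfect_matching (P n) M' := walk_perfect_matching n5 w'P w'A.
  have cM' j : cut M' (p + j) = w (j %% n).
    rewrite (cut_walk n5 w'P w'A) /w'; congr w.
    have -> : (p + j).+2 + K = p.+1 * n + j.
      by have := leq_pmulr p n0; rewrite /K mulSn mulnBr muln1; lia.
    by rewrite modnMDl.
  have sSM' : S \subset M'.
    apply: (subset_allowed (p := p)) => // j ltjn.
    have := cM' j.+1; rewrite addnS cM' => ->.
    by have := wP j; rewrite (modn_small ltjn).
  have /eqP eM : M' == M by apply: (implyP (fS M')); rewrite pM' sSM'.
  move: wi; rewrite -eM cM'; case: (ltngtP i n) lein => // [lt|->] _.
    by rewrite modn_small // eqxx.
  by rewrite modnn w0 wn eqxx.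
rewrite /forcing_set sSM; apply/forallP => M'; apply/implyP => /andP[pM' sSM'].
apply: contraT => neM.
suff /existsP[i neq] : [exists i : 'I_n, cut M' (p + i) != cut M (p + i)].
  have /negP[] := D0 (cut M' p); apply/DP; exists (fun i => cut M' (p + i)).
  split; rewrite ?addn0 //; first by apply: (cut_periodic n5); rewrite modnDr.
    by move=> j _; rewrite addnS; apply: cut_allowed.
  by exists i => //; apply: ltnW.
apply: contraR neM => /existsPn eqc; apply/eqP/(cut_inj pM' pM (p := p)) => i ltin.
by apply/eqP; have := eqc (Ordinal ltin); rewrite negbK.
Qed.

(* The unique transition to a position whose spoke is unused. *)
Definition spokeless_step (s : state) : state := let: (x, y, z) := s in (y, ~~ x, ~~ z).

(** [spokeless_step] has order dividing 4; this is where gaps modulo 4 come from. *)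
Lemma iter_spokeless t s : iter t spokeless_step s = iter (t %% 4) spokeless_step s.
Proof.
rewrite {1}(divn_eq t 4); elim: (t %/ 4) => [|q IHq]; first by rewrite mul0n.
rewrite mulSn -addnA [4 + _]/= !iterS {}IHq.
by case: (iter _ _ _) => [[[] []] []].
Qed.

(** * Parity of cut states and the class M1 *)

Definition parity (s : state) : bool := let: (x, y, z) := s in x (+) y (+) z.

(** Since x, a exclude each other and so do z, b, the equation in [allowed] reads x + a = z + b
    modulo 2. *)
Lemma allowed_parity c s t : allowed c s t -> parity t = parity s.
Proof.
case: c s t => [[? ?] ?] [[x y] z] [[y' a] b] /= /and5P[/eqP-> xa zb /eqP + _].
by move: xa zb; case: x y z a b => [] [] [] [] [].
Qed.

Lemma cut_parity (M : edges) i j :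
  perfect_matching (P n) M -> parity (cut M i) = parity (cut M j).
Proof.
move=> pM; have {}pM k : parity (cut M k) = parity (cut M 0).
  elim: k => // k <-; apply: allowed_parity (cut_allowed n5 k pM (sub0set M)).
by rewrite !pM.
Qed.

Lemma spoke_cut (M : edges) i : perfect_matching (P n) M -> spoke n i \in M ->
  let y := parity (cut M 0) in
  cut M (i + (n - 2)) = (false, y, false) /\ cut M (i + (n - 1)) = (y, false, false).
Proof.
move=> pM; set i' := i + (n - 2); have -> : i + (n - 1) = i'.+1 by rewrite /i'; lia.
have ii' : i = i'.+2 %[mod n] by rewrite (_ : i'.+2 = i + n) ?modnDr // /i'; lia.
rewrite -[spoke n i]/(edge n None i) (edge_mod n5 None ii') => sM y.
rewrite {}/y -(cut_parity i' 0 pM).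
have := cut_allowed n5 i' pM (sub0set M); have := marks_cut n5 i' pM.
rewrite /marks sM; case: (cut M i') (cut M i'.+1) => [[x y] z] [[y' a] b] /=.
case=> _ /esym /norP[x0 a0] _ /and5P[/eqP-> _ _ /eqP + _].
by rewrite (negPf x0) (negPf a0); case: z => //; case: b => //; case: (y).
Qed.

Lemma spokeless_cut (M : edges) i t : perfect_matching (P n) M ->
    (forall k, i < k < i + t.+1 -> spoke n k \notin M) ->
  cut M (i + (n - 1) + t) = iter t spokeless_step (cut M (i + (n - 1))).
Proof.
move=> pM; elim: t => [|t IHt] no; first by rewrite addn0.
rewrite addnS iterS -IHt; last by move=> k ?; apply: no; lia.
have := marks_cut n5 (i + (n - 1) + t) pM.
have := cut_allowed n5 (i + (n - 1) + t) pM (sub0set M).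
have -> : marks M (i + (n - 1) + t).+2 = marks M (i + t.+1).
  by apply: (marks_periodic n5); rewrite (_ : _.+2 = i + t.+1 + n) ?modnDr //; lia.
have /negPf := no (i + t.+1) ltac:(lia).
rewrite -[spoke n _]/(edge n None _) /marks => ->.
case: (cut M (_ + t)) (cut M (_ + t).+1) => [[x y] z] [[y' a] b] /= + [_ + _].
move=> /and5P[/eqP-> xa zb /eqP + _]; move: xa zb.
by case: x z a b => [] [] [] [].
Qed.

(** The spokeless steps lead from (y, false, false) after one spoke to (false, y, false) before the
    next, where y is the parity; modulo 4 this takes 0 steps for y = false and 2 for y = true. *)
Lemma consecutive_spokes_gap (M : edges) i j :
    perfect_matching (P n) M -> consecutive_spokes M i j ->
  (j - i - 1) %% 4 = if parity (cut M 0) then 2 else 0.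
Proof.
move=> pM [/andP[ltij _] iM jM no].
have [_ ci] := spoke_cut pM iM; have [cj _] := spoke_cut pM jM.
have := @spokeless_cut M i (j - i - 1) pM.
rewrite (_ : i + (n - 1) + _ = j + (n - 2)); last by lia.
rewrite (_ : i + (j - i - 1).+1 = j); last by lia.
move=> /(_ no); rewrite ci cj iter_spokeless.
have := ltn_pmod (j - i - 1) (isT : 0 < 4).
by case: (_ %% 4) => [|[|[|[]]]] //; case: parity.
Qed.

Lemma spoke_addn i : spoke n (i + n) = spoke n i.
Proof. by apply: (edge_mod n5 None); rewrite modnDr. Qed.

Lemma M1_parity (M : edges) : M1 M -> parity (cut M 0) = false.
Proof.
case=> pM [[[i iM] gap]|[_ n4 [i dM]]].
  have ex : exists j, (i < j) && (spoke n j \in M).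
    by exists (i + n); rewrite spoke_addn iM andbT; lia.
  case: (ex_minnP ex) => j /andP[ltij jM] jmin.
  have ijM : consecutive_spokes M i j.
    split=> //; first by rewrite ltij jmin // spoke_addn iM andbT; lia.
    move=> k /andP[ltik ltkj]; apply: contraL ltkj => kM; rewrite -leqNgt.
    by rewrite jmin // ltik.
  have := gap i j ijM; rewrite (consecutive_spokes_gap pM ijM).
  by case: parity.
have n40 : 0 < n %/ 4 by rewrite divn_gt0 //; lia.
(* These edges of the block k = 0 yield the even state (true, true, false). *)
have [a0 [a1 b0]] : edge n (Some true) i \in M /\ edge n (Some true) i.+1 \in M
                    /\ edge n (Some false) i \in M.
  have e0 : i + 4 * (Ordinal n40) = i by rewrite muln0 addn0.
  rewrite dM; split; [|split]; apply/bigcupP; exists (Ordinal n40); rewrite // e0.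
  - by rewrite !inE eqxx.
  - by rewrite /edge addSnnS -[i.+1]addn1 !inE eqxx orbT.
  - by rewrite !inE eqxx !orbT.
have [_ /(_ i)[_ b1]] := (perfect_matchingP n5 M).1 pM.
rewrite (cut_parity 0 i pM) /cut a0 a1; move: b1; rewrite b0.
by case: (edge n _ i.+1 \in M).
Qed.

Lemma parity_M1 (M : edges) : perfect_matching (P n) M ->
  (exists i, spoke n i \in M) -> parity (cut M 0) = false -> M1 M.
Proof.
move=> pM iM par; split=> //; left; split=> // i j /(consecutive_spokes_gap pM).
by rewrite par => ->.
Qed.

(** The nonzero even states form a forced chain 011, 110, 101 that ends in 000. *)
Lemma cut_zero (M : edges) : perfect_matching (P n) M -> parity (cut M 0) = false ->
  exists i, cut M i = zero.
Proof.
move=> pM even; have e i := etrans (cut_parity i 0 pM) even.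
have a i := cut_allowed n5 i pM (sub0set M).
have z1 i : cut M i = (true, false, true) -> cut M i.+1 = zero.
  by move=> ci; have := a i; rewrite ci; case: (cut M _) => [[[] []] []].
have z2 i : cut M i = (true, true, false) -> cut M i.+1 = (true, false, true).
  by move=> ci; have := a i; rewrite ci; case: (cut M _) => [[[] []] []].
have z3 i : cut M i = (false, true, true) -> cut M i.+1 = (true, true, false).
  by move=> ci; have := a i; rewrite ci; case: (cut M _) => [[[] []] []].
case c: (cut M 0) (e 0) => [[[] []] []] //= _.
- by exists 2; apply/z1/z2.
- by exists 1; apply/z1.
- by exists 3; apply/z1/z2/z3.
- by exists 0.
Qed.

(** * The lower bound for forcing sets *)

Lemma sum_shift (F : nat -> nat) q : (forall i, F (i + n) = F i) ->
  \sum_(i < n) F (q + i) = \sum_(i < n) F i.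
Proof.
move=> FP; elim: q => [|q <-]; first by apply: eq_bigr.
apply: (@addnI (F q)).
have := erefl (\sum_(i < n.+1) F (q + i)); rewrite {1}big_ord_recl big_ord_recr /=.
rewrite FP addn0 [RHS]addnC => <-; congr (_ + _).
by apply: eq_bigr => i _; rewrite addSnnS.
Qed.

Lemma forcing_set_card (M S : edges) :
  M1 M -> forcing_set (P n) M S -> n + 2 <= 6 * #|S|.
Proof.
move=> M1M fS; have pM := M1M.1; have sSM : S \subset M by case/andP: fS.
have [p cp] := cut_zero pM (M1_parity M1M).
have D0 := (forcing_setP pM sSM cp).1 fS.
apply: leq_trans (_ : n + 2 <= 6 * \sum_(i < n) weight (marks S (p + i).+2)) _.
  apply: (deviations_weight _ _ _ _ D0); rewrite ?addn0 //; first by lia.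
    by rewrite -cp; apply: (cut_periodic n5); rewrite modnDr.
  by move=> i _; rewrite addnS; apply: cut_allowed.
rewrite leq_mul2l /= (sum_shift (F := fun i => weight (marks S i.+2)) p) => [|i].
  rewrite (sum_shift (F := fun i => weight (marks S i)) 2) => [|i].
    exact: sum_marks_le.
  by congr weight; apply: (marks_periodic n5); rewrite modnDr.
by congr weight; apply: (marks_periodic n5); rewrite -2!addSn modnDr.
Qed.

End Forcing.

(** * Matchings with few forcing edges *)

(* A letter (t, c) moves M to the state t and puts the marks c at that position. *)
Definition word : Type := seq (state * state).

Definition spoke_tile (c : bool) : word := [:: (zero, (false, c, false))].

(** The loop at [zero] through the other three even states. Starting at position i, the arguments
    mark u_i u_(i+2), v_i v_(i+1), u_(i+1) u_(i+3) and v_(i+2) v_(i+3). *)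
Definition block_tile (a b a' b' : bool) : word :=
  [:: ((false, true, true), (a, false, b)); ((true, true, false), (a', false, false));
      ((true, false, true), (false, false, b')); (zero, zero)].

Definition word_step (x y : state * state) : bool := allowed y.2 x.1 y.1.

Definition scan (x : state * seq (seq bool)) (W : word) : state * seq (seq bool) :=
  foldl (fun x l => (l.1, advance x.1 l.1 l.2 x.2)) x W.

Definition word_weight (W : word) : nat := sumn [seq weight l.2 | l <- W].

Definition closed_word (W : word) : bool :=
  path word_step (zero, zero) W && ((last (zero, zero) W).1 == zero).

Lemma eq_deviations m m' c c' n :
    (forall i, i <= n -> m i = m' i) -> (forall i, i < n -> c i = c' i) ->
  deviations m c n = deviations m' c' n.
Proof.
elim: n => //= n IHn mm' cc'; rewrite !mm' ?cc' ?IHn // => i lein.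
  by apply: mm'; apply: leqW.
by apply: cc'; apply: leqW.
Qed.

(** * The matching and the marks given by a closed word *)

Section WordMatching.

Variable W : word.
Let n := size W.
Hypothesis n5 : 4 < n.
Hypothesis closedW : closed_word W.

Let w i := nth zero (zero :: unzip1 W) i.
Let c i := nth zero (unzip2 W) i.

Let w_n : w n = zero.
Proof.
have /andP[_ /eqP <-] := closedW.
by rewrite /w /n -(size_map fst) -last_nth -(last_map fst).
Qed.

Let w_allowed i : i < n -> allowed (c i) (w i) (w i.+1).
Proof.
move=> ltin; have /andP[/(pathP (zero, zero))/(_ i ltin) + _] := closedW.
have -> : c i = (nth (zero, zero) W i).2 by rewrite /c (nth_map (zero, zero)).
have -> : w i.+1 = (nth (zero, zero) W i).1 by rewrite /w /= (nth_map (zero, zero)).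
have -> // : w i = (nth (zero, zero) ((zero, zero) :: W) i).1.
rewrite /w -[_ :: unzip1 W]/(unzip1 ((zero, zero) :: W)).
by rewrite (nth_map (zero, zero)) //= ltnS ltnW.
Qed.

Let w_window := periodic_window (ltnW (ltnW (ltnW (ltnW n5)))) w_n w_allowed.

Let word_matching := walk_matching n (fun i => w (i %% n)).

Let word_marks := edge_set n (fun i => c (i %% n)).

Let w_periodic i j : i = j %[mod n] -> w (i %% n) = w (j %% n).
Proof. by move=> ->. Qed.

Let w_zero i : allowed zero (w (i %% n)) (w (i.+1 %% n)).
Proof.
move: (w_window i); case: (c _) (w _) (w _) => [[? ?] ?] [[? ?] ?] [[? ?] ?] /=.
by case/and5P=> -> -> -> ->.
Qed.

Let pm : perfect_matching (P n) word_matching.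
Proof. exact: (walk_perfect_matching n5 w_periodic w_zero). Qed.

Let cut_word i : cut word_matching i = w (i.+2 %% n).
Proof. exact: (cut_walk n5 w_periodic w_zero). Qed.

Let marks_word i : marks word_marks i = c (i %% n).
Proof. by apply: (marks_edge_set n5) => ? ? ->. Qed.

Let shift i : (n - 2 + i).+2 %% n = i %% n.
Proof. by rewrite (_ : (_ + i).+2 = n + i) ?modnDl //; lia. Qed.

Lemma scan_deviations : scan (zero, initial) W = (zero, deviations w c n).
Proof.
suff sc i : i <= n -> scan (zero, initial) (take i W) = (w i, deviations w c i).
  by have := sc n (leqnn n); rewrite take_size w_n.
elim: i => [|i IHi] lein; first by rewrite take0.
rewrite (take_nth (zero, zero)) // /scan foldl_rcons -/(scan _ _) IHi 1?ltnW //=.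
have -> : c i = (nth (zero, zero) W i).2 by rewrite /c (nth_map (zero, zero)).
by have -> : w i.+1 = (nth (zero, zero) W i).1 by rewrite /w /= (nth_map (zero, zero)).
Qed.

(** A first letter from [zero] to [zero] puts the spoke at 0 into the matching, so even parity gives
    the first case of M1. *)
Lemma word_matching_forced :
    (nth (zero, zero) W 0).1 = zero ->
    (forall s, ~~ entry (scan (zero, initial) W).2 s s) ->
  exists M S : {set {set gp_vertex n}},
    [/\ M1 M, forcing_set (P n) M S & #|S| <= word_weight W].
Proof.
move=> W0 D0; exists word_matching, word_marks.
have n0 : 0 < n by lia.
have w1 : w 1 = zero by rewrite /w /= (nth_map (zero, zero)).
split.
- apply: (parity_M1 n5 pm).
    exists 0; have := marks_walk n5 w_periodic 0.
    rewrite /marks mod0n modn_small; last by lia.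
    by rewrite w1 => -[_ + _]; rewrite -[spoke n 0]/(edge n None 0) => ->.
  by rewrite (cut_parity n5 0 (n - 2) pm) cut_word -[n - 2]addn0 shift mod0n.
(* The index n - 2 denotes the cut before position n, that is before position 0, where the word
   begins. *)
- have cp : cut word_matching (n - 2) = zero.
    by rewrite cut_word -[n - 2]addn0 shift mod0n.
  have sub : word_marks \subset word_matching.
    apply: (subset_allowed n5 (p := n - 2) (edge_set_sub n5 _) pm) => i ltin.
    by have := w_window i; rewrite marks_word !cut_word -(shift i) -(shift i.+1) addnS.
  apply/(forcing_setP n5 pm sub cp) => s; move: (D0 s).
  rewrite scan_deviations /= (@eq_deviations _ w _ c) // => i lein.
    rewrite cut_word shift; case: ltngtP lein => // [lt|->] _.
      by rewrite modn_small.
    by rewrite modnn w_n.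
  by rewrite marks_word shift modn_small.
- apply: leq_trans (card_edge_set _ _) _.
  rewrite /word_weight (_ : [seq _ | _ <- _] = [seq weight x | x <- unzip2 W]).
    rewrite sumnE big_map (big_nth zero) big_mkord size_map; apply: leq_sum => i _.
    by rewrite modn_small.
  by rewrite -map_comp.
Qed.

End WordMatching.

(* The loop and the base words were found by computer search. *)
Definition loop_word : word :=
  nseq 3 (zero, zero) ++ block_tile false false false true ++ spoke_tile false
    ++ block_tile false true false false.

Definition base_words : seq word :=
  let s := spoke_tile false in
  let S := s ++ s ++ s ++ spoke_tile true in
  let B1 := block_tile true false false false in
  let B2 := block_tile false true false false in
  let B3 := block_tile false false true false in
  let B4 := block_tile false false false true in
  [:: S ++ S ++ s ++ s ++ spoke_tile true;
      S ++ S ++ S;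
      S ++ S ++ s ++ B2;
      S ++ s ++ B4 ++ s ++ B2;
      S ++ s ++ s ++ s ++ B3 ++ B2;
      S ++ s ++ s ++ s ++ B4 ++ s ++ B2;
      S ++ S ++ S ++ s ++ B2;
      S ++ S ++ s ++ s ++ B3 ++ B1;
      S ++ S ++ s ++ s ++ s ++ B3 ++ B1;
      S ++ S ++ s ++ s ++ s ++ B4 ++ s ++ B2;
      S ++ s ++ s ++ s ++ B4 ++ s ++ B2 ++ s ++ B2;
      s ++ s ++ s ++ B4 ++ B1 ++ s ++ s ++ s ++ B3 ++ B2].

(** * Words of every length from 11 on *)

Definition extensible (W : word) : bool :=
  let x := scan (zero, initial) W in
  [&& closed_word W, (nth (zero, zero) W 0).1 == zero, scan x loop_word == x,
      all (fun s => ~~ entry x.2 s s) states & 6 * word_weight W <= size W + 7].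

Lemma base_words_extensible :
  all extensible base_words && (map size base_words == iota 11 12).
Proof. by vm_compute. Qed.

(** The loop fixes the scanned relation, and its 12 letters with 2 marks raise both sides of the
    weight inequality by 12. *)
Lemma extensible_cat W : extensible W -> extensible (W ++ loop_word).
Proof.
case/and5P=> /andP[pW /eqP lW] /eqP W0 /eqP sc D0 wt.
have scW : scan (zero, initial) (W ++ loop_word) = scan (zero, initial) W.
  by rewrite -[RHS]sc /scan foldl_cat.
rewrite /extensible scW sc D0 eqxx /=; apply/and3P; split.
- rewrite /closed_word cat_path pW last_cat /=.
  by move: lW; case: (last _ W) => [x ?] /= ->; vm_compute.
- by rewrite nth_cat; case: ifP => // _; rewrite W0.
- rewrite /word_weight map_cat sumn_cat -/(word_weight W) size_cat.
  have -> : size loop_word = 12 by [].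
  have -> : sumn [seq weight l.2 | l <- loop_word] = 2 by [].
  by lia.
Qed.

Lemma extensible_word n : 10 < n -> exists2 W, extensible W & size W = n.
Proof.
move=> n10; have /andP[/allP xb /eqP sb] := base_words_extensible.
have n0 : n = nth 0 (map size base_words) ((n - 11) %% 12) + (n - 11) %/ 12 * 12.
  have lt := ltn_pmod (n - 11) (isT : 0 < 12).
  by rewrite sb nth_iota // {1}(_ : n = 11 + (n - 11)) 1?{1}(divn_eq (n - 11) 12); lia.
rewrite n0 (nth_map [::]) ?ltn_pmod //.
elim: (_ %/ 12) => [|k [W xW sW]].
  rewrite addn0; exists (nth [::] base_words ((n - 11) %% 12)) => //.
  by apply/xb/mem_nth; rewrite ltn_pmod.
exists (W ++ loop_word); first exact: extensible_cat.
by rewrite size_cat sW mulSn [12 + _]addnC addnA.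
Qed.

(** * The minimum forcing number *)

Lemma forcing_number_le (T : finType) (E M S : {set {set T}}) :
  perfect_matching E M -> forcing_set E M S -> forcing_number E M <= #|S|.
Proof.
move=> pM fS; rewrite /forcing_number.
by case: arg_minnP => [|S' _ minS']; [exact: forcing_set_self | exact: minS'].
Qed.

Lemma forcing_number_bound n (M : {set {set gp_vertex n}}) :
  4 < n -> M1 M -> n + 2 <= 6 * forcing_number (P n) M.
Proof.
move=> n5 M1M; rewrite /forcing_number.
case: arg_minnP => [|S fS _]; first by apply: forcing_set_self; case: M1M.
exact: (forcing_set_card n5 M1M).
Qed.

Lemma M1_small_forcing n : 10 < n ->
  exists2 M : {set {set gp_vertex n}}, M1 M & 6 * forcing_number (P n) M <= n + 7.
Proof.
move=> n10; have [W xW sW] := extensible_word n10.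
have n5 : 4 < size W by rewrite sW; lia.
case/and5P: xW => cW /eqP W0 _ /allP D0 wt; rewrite -sW.
have [M [S [M1M fS cS]]] :=
  word_matching_forced n5 cW W0 (fun s => D0 s (mem_states s)).
exists M => //; apply: leq_trans wt; rewrite leq_mul2l /=.
by apply: leq_trans cS; apply: forcing_number_le fS; case: M1M.
Qed.

Theorem theorem3p2 (n : nat) (hn : 11 <= n) :
  is_minimum
    (fun k : int => exists2 M : {set {set gp_vertex n}},
       M1 M & k = Posz (forcing_number (P n) M))
    (Num.ceil ((n + 2)%:R / 6%:R : rat)%R).
Proof.
have n5 : 4 < n by lia.
have ceil_f f : n + 2 <= 6 * f -> (Num.ceil ((n + 2)%:R / 6%:R : rat) <= Posz f)%R.
  move=> le_f; rewrite Num.Theory.ceil_le_int -[(Posz f)%:~R%R]/(f%:R)%R.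
  by rewrite ler_pdivrMr // -natrM ler_nat mulnC.
split=> [|_ [M M1M ->]]; last exact/ceil_f/forcing_number_bound.
have [M M1M le_f] := M1_small_forcing hn; have ge_f := forcing_number_bound n5 M1M.
exists M => //; apply/eqP; rewrite eq_le ceil_f //=.
case: (forcing_number _ _) le_f ge_f => [|f] le_f _.
  by rewrite ceil_ge0 (lt_le_trans (ltrN10 _)) ?divr_ge0.
(* The goal reduces to f < (n + 2) / 6, and 6 (f + 1) <= n + 7 gives 6 f < n + 2. *)
rewrite -[f.+1]addn1 PoszD lezD1 ceil_gt_int -[(Posz f)%:~R%R]/(f%:R)%R.
by rewrite ltr_pdivlMr // -natrM ltr_nat; lia.
Qed.
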